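(* Let $R$ be a reduced $F$-finite commutative noetherian ring, essentially of finite type over a field of characteristic $p>0$, and having a dualizing complex. If $R$ is $F$-injective, then $R$ is weakly normal (and thus in particular seminormal).
   Context: **$F$-finiteness and $F$-injectivity.** For a ring $R$ of characteristic $p$, ${}^1R$ denotes $R$ viewed as an $R$-module via Frobenius $F:R\to R$, $x\mapsto x^p$; $R$ is *$F$-finite* if ${}^1R$ is a finite $R$-module. A reduced local ring $(R,\mathfrak m)$ of characteristic $p$ is *$F$-injective* if the map $H^i_{\mathfrak m}(R)\to H^i_{\mathfrak m}({}^1R)$ induced by Frobenius is injective for all $i$. An $F$-finite ring $R$ with a dualizing complex is *$F$-injective* if the local ring $R_P$ is $F$-injective for every $P\in\operatorname{Spec}R$. **Seminormality and weak normality.** A finite extension of reduced rings $A\subset B$ is *subintegral* (resp. *weakly subintegral* ) if $\operatorname{Spec}B\to\operatorname{Spec}A$ is a bijection and, for every $P\in\operatorname{Spec}B$, the residue field extension $k(P\cap A)\to k(P)$ is an isomorphism (resp. purely inseparable). For a finite extension $A\subset B$ of reduced rings there is a unique largest subring $C$ with $A\subset C\subset B$ and $A\subset C$ subintegral (resp. weakly subintegral); $A$ is *seminormal in $B$* (resp. *weakly normal in $B$* ) if $C=A$. A reduced ring $A$ is *seminormal* (resp. *weakly normal* ) if it is so in its integral closure $\overline A$ in its total ring of fractions. *)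

(* Defs.v *)
From HB Require Import structures.
From mathcomp Require Import all_boot all_order all_algebra.
From mathcomp Require Import boolp classical_sets.
From mathcomp Require Import ring.

Set Implicit Arguments.
Unset Strict Implicit.
Unset Printing Implicit Defensive.

Import GRing.Theory.
Local Open Scope ring_scope.
Local Open Scope quotient_scope.
Local Open Scope classical_set_scope.

(* Rings are comNzRingType (1 != 0): the zero ring does not have
   characteristic p. *)

Record ideal (R : comNzRingType) := Ideal {
  ideal_set :> R -> Prop;
  ideal0 : ideal_set 0;
  idealD : forall x y, ideal_set x -> ideal_set y -> ideal_set (x + y);
  idealM : forall a x, ideal_set x -> ideal_set (a * x) }.

Record Spec (R : comNzRingType) := Prime {
  prime_ideal :> ideal R;
  prime_proper : ~ prime_ideal 1;
  prime_mul : forall x y,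
    prime_ideal (x * y) -> prime_ideal x \/ prime_ideal y }.

Definition noetherian (R : comNzRingType) := forall I : ideal R,
  exists s : seq R, forall x,
    I x <-> exists c : nat -> R, x = \sum_(i < size s) c i * s`_i.

Definition reduced (R : comNzRingType) :=
  forall (x : R) n, x ^+ n = 0 -> x = 0.

Lemma ideal0_0 (R : comNzRingType) : [set 0 : R] 0. Proof. by []. Qed.
Lemma ideal0_D (R : comNzRingType) (x y : R) :
  [set 0] x -> [set 0] y -> [set 0] (x + y).
Proof. by move=> -> ->; rewrite /= addr0. Qed.
Lemma ideal0_M (R : comNzRingType) (a x : R) : [set 0] x -> [set 0] (a * x).
Proof. by move=> ->; rewrite /= mulr0. Qed.
Definition zero_ideal (R : comNzRingType) : ideal R :=
  Ideal (@ideal0_0 R) (@ideal0_D R) (@ideal0_M R).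

(* Multiplicatively closed sets disjoint from I; [frac_ring I W] below is
   W^-1 (R / I).  Taking I = 0 gives the usual localizations, and taking I = P,
   W = R \ P gives the residue field k(P) = Frac (R / P). *)
Record denoms (R : comNzRingType) (I : ideal R) := Denoms {
  denoms_set :> R -> Prop;
  denoms1 : denoms_set 1;
  denomsM : forall x y, denoms_set x -> denoms_set y -> denoms_set (x * y);
  denoms_disj : forall x, denoms_set x -> ~ I x }.

Section FracRing.
Variables (R : comNzRingType) (I : ideal R) (W : denoms I).

Record ratio := Ratio { num : R; den : R; den_in : W den }.
HB.instance Definition _ := gen_eqMixin ratio.
HB.instance Definition _ := gen_choiceMixin ratio.

Definition frac_rel_prop (x y : ratio) :=
  exists2 u, W u & I (u * (num x * den y - num y * den x)).
Definition frac_rel (x y : ratio) := `[< frac_rel_prop x y >].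

Lemma ideal_eq (x y : R) : I x -> x = y -> I y. Proof. by move=> ? <-. Qed.

Lemma frac_rel_refl : reflexive frac_rel.
Proof.
move=> x; apply/asboolP; exists 1; first exact: denoms1.
by rewrite subrr mulr0; apply: ideal0.
Qed.

Lemma frac_rel_sym : symmetric frac_rel.
Proof.
have h x y : frac_rel x y -> frac_rel y x.
  move=> /asboolP[u Wu Iu]; apply/asboolP; exists u => //.
  by apply: ideal_eq (idealM (-1) Iu) _; ring.
by move=> x y; apply/idP/idP; apply: h.
Qed.

Lemma frac_rel_trans : transitive frac_rel.
Proof.
move=> y x z /asboolP[u Wu Iu] /asboolP[v Wv Iv]; apply/asboolP.
exists (den y * (u * v)); first exact: denomsM (den_in y) (denomsM Wu Wv).
apply: ideal_eq (idealD (idealM (v * den z) Iu) (idealM (u * den x) Iv)) _.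
by ring.
Qed.

Definition frac_equiv := EquivRel frac_rel frac_rel_refl frac_rel_sym
  frac_rel_trans.

Definition frac_ring := {eq_quot frac_equiv}.
HB.instance Definition _ := EqQuotient.on frac_ring.
HB.instance Definition _ := Choice.on frac_ring.

Definition frac a s (Ws : W s) : frac_ring := \pi_frac_ring (Ratio a Ws).

Lemma fracP a s (Ws : W s) b t (Wt : W t) :
  frac a Ws = frac b Wt <-> exists2 u, W u & I (u * (a * t - b * s)).
Proof.
rewrite /frac; split=> [/eqmodP/asboolP//|h].
by apply/eqmodP; apply/asboolP.
Qed.

Lemma frac_repr (x : frac_ring) : x = frac (num (repr x)) (den_in (repr x)).
Proof. by rewrite -[LHS]reprK /frac; case: (repr x). Qed.

Lemma fracW (P : frac_ring -> Prop) :
  (forall a s (Ws : W s), P (frac a Ws)) -> forall x, P x.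
Proof. by move=> h x; rewrite [x]frac_repr. Qed.

Let W1 := denoms1 W.

Definition frac_zero := frac 0 W1.
Definition frac_one := frac 1 W1.
Definition frac_opp (x : frac_ring) :=
  frac (- num (repr x)) (den_in (repr x)).
Definition frac_add (x y : frac_ring) :=
  frac (num (repr x) * den (repr y) + num (repr y) * den (repr x))
       (denomsM (den_in (repr x)) (den_in (repr y))).
Definition frac_mul (x y : frac_ring) :=
  frac (num (repr x) * num (repr y))
       (denomsM (den_in (repr x)) (den_in (repr y))).

Lemma fracE a s (Ws : W s) : exists2 u, W u &
  I (u * (num (repr (frac a Ws)) * s - a * den (repr (frac a Ws)))).
Proof. by have /fracP := esym (frac_repr (frac a Ws)). Qed.

Lemma frac_oppE a s (Ws : W s) : frac_opp (frac a Ws) = frac (- a) Ws.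
Proof.
rewrite /frac_opp; have [u Wu Iu] := fracE a Ws.
apply/fracP; exists u => //.
by apply: ideal_eq (idealM (-1) Iu) _; ring.
Qed.

Lemma frac_addE a s (Ws : W s) b t (Wt : W t) :
  frac_add (frac a Ws) (frac b Wt) = frac (a * t + b * s) (denomsM Ws Wt).
Proof.
rewrite /frac_add; have [u Wu Iu] := fracE a Ws; have [v Wv Iv] := fracE b Wt.
set x := repr (frac a Ws) in Iu *; set y := repr (frac b Wt) in Iv *.
apply/fracP; exists (u * v); first exact: denomsM.
apply: ideal_eq (idealD (idealM (v * t * den y) Iu)
                        (idealM (u * s * den x) Iv)) _.
by ring.
Qed.

Lemma frac_mulE a s (Ws : W s) b t (Wt : W t) :
  frac_mul (frac a Ws) (frac b Wt) = frac (a * b) (denomsM Ws Wt).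
Proof.
rewrite /frac_mul; have [u Wu Iu] := fracE a Ws; have [v Wv Iv] := fracE b Wt.
set x := repr (frac a Ws) in Iu *; set y := repr (frac b Wt) in Iv *.
apply/fracP; exists (u * v); first exact: denomsM.
apply: ideal_eq (idealD (idealM (v * t * num y) Iu)
                        (idealM (u * a * den x) Iv)) _.
by ring.
Qed.

Lemma frac_eq a s (Ws : W s) b t (Wt : W t) :
  a * t = b * s -> frac a Ws = frac b Wt.
Proof.
move=> e; apply/fracP; exists 1; first exact: W1.
by rewrite e subrr mulr0; apply: ideal0.
Qed.

Lemma frac_addA : associative frac_add.
Proof.
elim/fracW=> a s Ws; elim/fracW=> b t Wt; elim/fracW=> c r Wr.
by rewrite !frac_addE; apply: frac_eq; ring.
Qed.

Lemma frac_addC : commutative frac_add.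
Proof.
elim/fracW=> a s Ws; elim/fracW=> b t Wt.
by rewrite !frac_addE; apply: frac_eq; ring.
Qed.

Lemma frac_add0 : left_id frac_zero frac_add.
Proof. by elim/fracW=> a s Ws; rewrite !frac_addE; apply: frac_eq; ring. Qed.

Lemma frac_addN : left_inverse frac_zero frac_opp frac_add.
Proof.
by elim/fracW=> a s Ws; rewrite frac_oppE !frac_addE; apply: frac_eq; ring.
Qed.

Lemma frac_mulA : associative frac_mul.
Proof.
elim/fracW=> a s Ws; elim/fracW=> b t Wt; elim/fracW=> c r Wr.
by rewrite !frac_mulE; apply: frac_eq; ring.
Qed.

Lemma frac_mulC : commutative frac_mul.
Proof.
elim/fracW=> a s Ws; elim/fracW=> b t Wt.
by rewrite !frac_mulE; apply: frac_eq; ring.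
Qed.

Lemma frac_mul1 : left_id frac_one frac_mul.
Proof. by elim/fracW=> a s Ws; rewrite !frac_mulE; apply: frac_eq; ring. Qed.

Lemma frac_mulD : left_distributive frac_mul frac_add.
Proof.
elim/fracW=> a s Ws; elim/fracW=> b t Wt; elim/fracW=> c r Wr.
by rewrite !(frac_addE, frac_mulE); apply: frac_eq; ring.
Qed.

Lemma frac_1neq0 : frac_one != frac_zero.
Proof.
apply/eqP => /fracP[u Wu Iu]; apply: (denoms_disj Wu).
by apply: ideal_eq Iu _; ring.
Qed.

HB.instance Definition _ := GRing.isZmodule.Build frac_ring
  frac_addA frac_addC frac_add0 frac_addN.
HB.instance Definition _ := GRing.Zmodule_isComNzRing.Build frac_ring
  frac_mulA frac_mulC frac_mul1 frac_mulD frac_1neq0.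

Lemma fracN a s (Ws : W s) : - frac a Ws = frac (- a) Ws.
Proof. exact: frac_oppE. Qed.
Lemma fracD a s (Ws : W s) b t (Wt : W t) :
  frac a Ws + frac b Wt = frac (a * t + b * s) (denomsM Ws Wt).
Proof. exact: frac_addE. Qed.
Lemma fracM a s (Ws : W s) b t (Wt : W t) :
  frac a Ws * frac b Wt = frac (a * b) (denomsM Ws Wt).
Proof. exact: frac_mulE. Qed.

Definition to_frac (a : R) : frac_ring := frac a W1.

Lemma to_frac_is_zmod_morphism : zmod_morphism to_frac.
Proof.
by move=> a b; rewrite /to_frac fracN fracD; apply: frac_eq; ring.
Qed.
Lemma to_frac_is_monoid_morphism : monoid_morphism to_frac.
Proof.
by split=> // a b; rewrite /to_frac fracM; apply: frac_eq; ring.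
Qed.
HB.instance Definition _ := GRing.isZmodMorphism.Build R frac_ring to_frac
  to_frac_is_zmod_morphism.
HB.instance Definition _ := GRing.isMonoidMorphism.Build R frac_ring to_frac
  to_frac_is_monoid_morphism.

End FracRing.

(* The map W^-1 (A / I) -> V^-1 (B / J) induced by phi : A -> B. *)
Section FracMap.
Variables (A B : comNzRingType) (phi : {rmorphism A -> B}).
Variables (I : ideal A) (J : ideal B) (W : denoms I) (V : denoms J).
Hypothesis phiI : forall x, I x -> J (phi x).
Hypothesis phiW : forall x, W x -> V (phi x).

Definition frac_map (x : frac_ring W) : frac_ring V :=
  frac (phi (num (repr x))) (phiW (den_in (repr x))).

Lemma frac_mapE a s (Ws : W s) :
  frac_map (frac a Ws) = frac (phi a) (phiW Ws).
Proof.
rewrite /frac_map; have [u Wu Iu] := fracE a Ws.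
apply/fracP; exists (phi u); first exact: phiW.
by have := phiI Iu; rewrite rmorphM rmorphB !rmorphM.
Qed.

Lemma frac_map_is_zmod_morphism : zmod_morphism frac_map.
Proof.
elim/fracW=> a s Ws; elim/fracW=> b t Wt.
rewrite fracN fracD !frac_mapE fracN fracD; apply: frac_eq.
by rewrite !(rmorphD, rmorphM, rmorphN).
Qed.
Lemma frac_map_is_monoid_morphism : monoid_morphism frac_map.
Proof.
split=> [|x y].
  by rewrite [LHS]frac_mapE; apply: frac_eq; rewrite rmorph1.
elim/fracW: x => a s Ws; elim/fracW: y => b t Wt.
by rewrite fracM !frac_mapE fracM; apply: frac_eq; rewrite !rmorphM.
Qed.
Definition frac_morph : {rmorphism frac_ring W -> frac_ring V} :=
  HB.pack frac_map
    (GRing.isZmodMorphism.Build _ _ frac_map frac_map_is_zmod_morphism)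
    (GRing.isMonoidMorphism.Build _ _ frac_map frac_map_is_monoid_morphism).
End FracMap.

Section PrimeComplement.
Variables (R : comNzRingType) (P : Spec R).

Lemma prime_compl1 : (~` ideal_set P) 1. Proof. exact: (@prime_proper _ P). Qed.
Lemma prime_complM x y : (~` ideal_set P) x -> (~` ideal_set P) y -> (~` ideal_set P) (x * y).
Proof. by move=> nx ny /prime_mul[]. Qed.
Lemma prime_compl_disj x : (~` ideal_set P) x -> ~ P x. Proof. by []. Qed.
Lemma prime_compl_disj0 x : (~` ideal_set P) x -> ~ zero_ideal R x.
Proof. by move=> nx x0; apply: nx; rewrite x0; apply: ideal0. Qed.

Definition local_at :=
  frac_ring (I := zero_ideal R)
            (Denoms prime_compl1 prime_complM prime_compl_disj0).
HB.instance Definition _ := GRing.ComNzRing.on local_at.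

Definition prime_compl : denoms P :=
  Denoms prime_compl1 prime_complM prime_compl_disj.
Definition residue_field := frac_ring prime_compl.
HB.instance Definition _ := GRing.ComNzRing.on residue_field.

Definition to_local : {rmorphism R -> local_at} := to_frac _.
End PrimeComplement.

Section TotalFractions.
Variable R : comNzRingType.

Definition regular_elts : set R := [set s | GRing.lreg s].
Lemma regular1 : regular_elts 1. Proof. exact: lreg1. Qed.
Lemma regularM x y :
  regular_elts x -> regular_elts y -> regular_elts (x * y).
Proof. exact: lregM. Qed.
Lemma regular_disj x : regular_elts x -> ~ zero_ideal R x.
Proof. by move=> /lreg_neq0/eqP. Qed.

Definition total_fractions :=
  frac_ring (I := zero_ideal R) (Denoms regular1 regularM regular_disj).
HB.instance Definition _ := GRing.ComNzRing.on total_fractions.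

Definition to_total : {rmorphism R -> total_fractions} := to_frac _.
End TotalFractions.

Section Preimage.
Variables (A B : comNzRingType) (phi : {rmorphism A -> B}).

Lemma preim0 (J : ideal B) : (phi @^-1` ideal_set J) 0.
Proof. by rewrite /= rmorph0; apply: ideal0. Qed.
Lemma preimD (J : ideal B) x y :
  (phi @^-1` ideal_set J) x -> (phi @^-1` ideal_set J) y -> (phi @^-1` ideal_set J) (x + y).
Proof. by rewrite /= rmorphD; apply: idealD. Qed.
Lemma preimM (J : ideal B) a x : (phi @^-1` ideal_set J) x -> (phi @^-1` ideal_set J) (a * x).
Proof. by rewrite /= rmorphM; apply: idealM. Qed.
Definition preim_ideal (J : ideal B) : ideal A :=
  Ideal (preim0 J) (@preimD J) (@preimM J).

Variable P : Spec B.
Lemma preim_proper : ~ preim_ideal P 1.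
Proof. by rewrite /= rmorph1; apply: prime_proper. Qed.
Lemma preim_mul x y :
  preim_ideal P (x * y) -> preim_ideal P x \/ preim_ideal P y.
Proof. by rewrite /= rmorphM; apply: prime_mul. Qed.
Definition Spec_map : Spec A := Prime preim_proper preim_mul.

Lemma residue_map_num x : Spec_map x -> P (phi x). Proof. by []. Qed.
Lemma residue_map_den x : prime_compl Spec_map x -> prime_compl P (phi x).
Proof. by []. Qed.
Definition residue_map :
    {rmorphism residue_field Spec_map -> residue_field P} :=
  frac_morph residue_map_num residue_map_den.
End Preimage.

(* [restr phi] is B as an A-module, via phi. *)
Section Restriction.
Variables (A B : comNzRingType) (phi : {rmorphism A -> B}).

Definition restr of {rmorphism A -> B} : Type := B.
Local Notation M := (restr phi).
HB.instance Definition _ := GRing.Zmodule.copy M B.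

Definition restr_scale (a : A) (x : M) : M := phi a * (x : B).
Lemma restr_scaleA a b x :
  restr_scale a (restr_scale b x) = restr_scale (a * b) x.
Proof. by rewrite /restr_scale rmorphM mulrA. Qed.
Lemma restr_scale1 : left_id 1 restr_scale.
Proof. by move=> x; rewrite /restr_scale rmorph1 mul1r. Qed.
Lemma restr_scaleDr : right_distributive restr_scale +%R.
Proof. by move=> a x y; apply: mulrDr. Qed.
Lemma restr_scaleDl x : {morph restr_scale^~ x : a b / a + b}.
Proof. by move=> a b; rewrite /restr_scale rmorphD; apply: mulrDl. Qed.
HB.instance Definition _ := GRing.Zmodule_isLmodule.Build A M
  restr_scaleA restr_scale1 restr_scaleDr restr_scaleDl.

Definition restr_map (x : A^o) : M := phi x.
Lemma restr_map_is_zmod_morphism : zmod_morphism restr_map.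
Proof. by move=> x y; apply: (rmorphB phi). Qed.
Lemma restr_map_is_scalable : scalable restr_map.
Proof. by move=> a x; apply: (rmorphM phi). Qed.
HB.instance Definition _ := GRing.isZmodMorphism.Build A^o M restr_map
  restr_map_is_zmod_morphism.
HB.instance Definition _ := GRing.isScalable.Build A A^o M *:%R restr_map
  restr_map_is_scalable.
End Restriction.

Definition finitely_generated (R : comNzRingType) (M : lmodType R) :=
  exists s : seq M, forall x, exists c : nat -> R,
    x = \sum_(i < size s) c i *: s`_i.

Definition Frobenius (R : comNzRingType) p (hR : p \in [pchar R]) :
  {rmorphism R -> R} := pFrobenius_aut hR.

(* [restr (Frobenius hR)] is the module ^1R. *)
Definition F_finite (R : comNzRingType) p (hR : p \in [pchar R]) :=
  finitely_generated (restr (Frobenius hR)).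

Definition ess_finite_type (k : fieldType) (R : comNzRingType) :=
  exists (S : comNzRingType) (f : {rmorphism k -> S}) (s : seq S),
    (forall A : pred S, GRing.subring_closed A ->
       (forall c, f c \in A) -> {subset s <= A} -> forall x, x \in A) /\
    exists (W : denoms (zero_ideal S)) (g : {rmorphism frac_ring W -> R}),
      bijective g.

Section Homological.
Variable R : comNzRingType.

(* d i j is only nonzero for j = i + 1; indexing it by both ends avoids casts
   between the terms of a complex. *)
Record complex := Complex {
  term :> int -> lmodType R;
  diff : forall i j, {linear term i -> term j};
  diff_off : forall i j, j != i + 1 -> forall x, diff i j x = 0;
  diff_diff : forall i j l x, diff j l (diff i j x) = 0 }.

Definition injective_module (E : lmodType R) :=
  forall (M N : lmodType R) (i : {linear M -> N}) (f : {linear M -> E}),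
    injective i -> exists g : {linear N -> E}, forall x, g (i x) = f x.

Definition zero_module (M : lmodType R) := forall x : M, x = 0.

Definition fg_cohomology (D : complex) i :=
  exists s : seq (D i),
    (forall z, z \in s -> diff D i (i + 1) z = 0) /\
    forall x : D i, diff D i (i + 1) x = 0 ->
      exists (c : nat -> R) (y : D (i - 1)),
        x = \sum_(l < size s) c l *: s`_l + diff D (i - 1) i y.

(* A homogeneous element of degree n of the total Hom complex of D with itself
   is represented by a family f of which only the f i (i + n) matter. *)
Definition hom_family (D : complex) := forall i j, {linear D i -> D j}.

Definition hom_diff (D : complex) (n : int) (f : hom_family D) i j (x : D i) :
    D j :=
  diff D (j - 1) j (f i (j - 1) x)
  - (-1) ^+ `|n|%N *: f (i + 1) j (diff D i (i + 1) x).

Definition hom_cocycle (D : complex) n (f : hom_family D) :=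
  forall (i j : int), j = i + (n + 1) -> forall x : D i, hom_diff n f j x = 0.

Definition dualizing_complex (D : complex) :=
  [/\ (exists a b : int, forall i, (i < a) || (b < i) -> zero_module (D i)),
      (forall i, injective_module (D i)),
      (forall i, fg_cohomology D i) &
  (* R -> Hom(D, D) is a quasi-isomorphism: H^0 = R by homotheties, and the
     cohomology in nonzero degrees vanishes *)
  [/\ (forall (r : R) (h : hom_family D),
         (forall i (x : D i), r *: x = hom_diff (-1) h i x) -> r = 0),
      (forall f : hom_family D, hom_cocycle 0 f ->
         exists (r : R) (h : hom_family D), forall i (x : D i),
           f i i x = r *: x + hom_diff (-1) h i x) &
      (forall n, n != 0 -> forall f : hom_family D, hom_cocycle n f ->
         exists h : hom_family D, forall i j : int, j = i + n ->
           forall x : D i, f i j x = hom_diff (n - 1) h j x)]].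

Definition has_dualizing_complex := exists D, dualizing_complex D.

Definition injective_resolution (M : lmodType R) (J : complex)
    (e : {linear M -> J 0}) :=
  [/\ (forall i, (i < 0)%R -> zero_module (J i)),
      (forall i, injective_module (J i)),
      injective e,
      (forall x, diff J 0 1 x = 0 <-> exists m, x = e m) &
      (forall i : int, 0 < i -> forall x,
         diff J i (i + 1) x = 0 <-> exists y, x = diff J (i - 1) i y)].

(* The elements killed by a power of the ideal m (m^n is generated by the
   products of n elements of m). *)
Definition torsion (m : set R) (M : lmodType R) : set M :=
  [set x | exists n : nat, forall a : 'I_n -> R,
     (forall i, m (a i)) -> (\prod_i a i) *: x = 0].

(* The map H^i_m(M) -> H^i_m(N) induced by f is injective, where H^i_m is the
   i-th right derived functor of [torsion m]: the map is the one induced on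
   cohomology by torsion m phi, for phi a lift of f to injective resolutions;
   it does not depend on the choices. *)
Definition local_cohomology_injective (m : set R) (M N : lmodType R)
    (f : {linear M -> N}) (i : int) :=
  exists (J : complex) (e : {linear M -> J 0})
         (J' : complex) (e' : {linear N -> J' 0})
         (phi : forall i, {linear J i -> J' i}),
    [/\ injective_resolution e, injective_resolution e',
        (forall x, phi 0 (e x) = e' (f x)),
        (forall i j x, phi j (diff J i j x) = diff J' i j (phi i x)) &
        forall x, torsion m x -> diff J i (i + 1) x = 0 ->
          (exists2 y, torsion m y & phi i x = diff J' (i - 1) i y) ->
          exists2 z, torsion m z & x = diff J (i - 1) i z].
End Homological.

(* For A local this is its maximal ideal. *)
Definition nonunits (A : comNzRingType) : set A :=
  [set x | ~ exists y, x * y = 1].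

Definition F_injective_local (A : comNzRingType) p (hA : p \in [pchar A]) :=
  forall i : int,
    local_cohomology_injective (@nonunits A) (restr_map (Frobenius hA)) i.

Definition F_injective (R : comNzRingType) p (hR : p \in [pchar R]) :=
  forall P : Spec R, F_injective_local (rmorph_pchar (to_local P) hR).

Record subring (B : comNzRingType) := Subring {
  subring_set :> B -> Prop;
  subring_set1 : subring_set 1;
  subring_setB : forall x y,
    subring_set x -> subring_set y -> subring_set (x - y);
  subring_setM : forall x y,
    subring_set x -> subring_set y -> subring_set (x * y) }.

Section SubringRing.
Variables (B : comNzRingType) (C : subring B).

Definition subring_pred : pred B := fun x => `[< C x >].
Lemma subring_pred_closed : GRing.subring_closed subring_pred.
Proof.
split=> [|x y /asboolP Cx /asboolP Cy|x y /asboolP Cx /asboolP Cy].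
- exact/asboolP/(subring_set1 C).
- exact/asboolP/(subring_setB Cx Cy).
- exact/asboolP/(subring_setM Cx Cy).
Qed.

Definition subring_ring := {x : B | subring_pred x}.
HB.instance Definition _ := SubChoice.on subring_ring.
HB.instance Definition _ := GRing.SubChoice_isSubComNzRing.Build B
  subring_pred subring_ring subring_pred_closed.

Variables (A : comNzRingType) (psi : {rmorphism A -> B}).
Hypothesis psiC : range psi `<=` subring_set C.

Lemma corestr_subproof x : subring_pred (psi x).
Proof. by apply/asboolP/psiC; exists x. Qed.
Definition corestr_fun (x : A) : subring_ring :=
  exist _ (psi x) (corestr_subproof x).
Lemma corestr_is_zmod_morphism : zmod_morphism corestr_fun.
Proof. by move=> x y; apply: val_inj; rewrite /= rmorphB. Qed.
Lemma corestr_is_monoid_morphism : monoid_morphism corestr_fun.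
Proof.
by split=> [|x y]; apply: val_inj; rewrite /= ?rmorph1 ?rmorphM.
Qed.
HB.instance Definition _ := GRing.isZmodMorphism.Build _ _ corestr_fun
  corestr_is_zmod_morphism.
HB.instance Definition _ := GRing.isMonoidMorphism.Build _ _ corestr_fun
  corestr_is_monoid_morphism.
Definition corestr : {rmorphism A -> subring_ring} := corestr_fun.
End SubringRing.

Section ImageSubring.
Variables (A B : comNzRingType) (psi : {rmorphism A -> B}).
Lemma range1 : range psi 1. Proof. by exists 1 => //; rewrite rmorph1. Qed.
Lemma rangeB x y : range psi x -> range psi y -> range psi (x - y).
Proof. by move=> [a _ <-] [b _ <-]; exists (a - b); rewrite ?rmorphB. Qed.
Lemma rangeM x y : range psi x -> range psi y -> range psi (x * y).
Proof. by move=> [a _ <-] [b _ <-]; exists (a * b); rewrite ?rmorphM. Qed.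
Definition image_subring : subring B := Subring range1 rangeB rangeM.
End ImageSubring.

Section IntegralClosure.
Variables (A B : comNzRingType) (psi : {rmorphism A -> B}).
Lemma integralOver1 : integralOver psi 1. Proof. exact: integral1. Qed.
Lemma integralOverB x y :
  integralOver psi x -> integralOver psi y -> integralOver psi (x - y).
Proof. exact: integral_sub. Qed.
Lemma integralOverM x y :
  integralOver psi x -> integralOver psi y -> integralOver psi (x * y).
Proof. exact: integral_mul. Qed.
Definition integral_closure : subring B :=
  Subring integralOver1 integralOverB integralOverM.
Lemma range_integral : range psi `<=` subring_set integral_closure.
Proof. by move=> _ [x _ <-]; apply: integral_id. Qed.
Definition to_integral_closure :
  {rmorphism A -> subring_ring integral_closure} := corestr range_integral.
End IntegralClosure.

Section WeakNormality.

(* In characteristic 0 the only n with [pchar L].-nat n is 1. *)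
Definition purely_inseparable_map (K L : comNzRingType)
    (h : {rmorphism K -> L}) :=
  forall y, exists n : nat, [pchar L].-nat n /\ range h (y ^+ n).

Variables (A B : comNzRingType) (psi : {rmorphism A -> B}).

Definition finite_reduced_extension :=
  [/\ reduced A, reduced B, injective psi & finitely_generated (restr psi)].

Definition subintegral :=
  [/\ finite_reduced_extension, bijective (Spec_map psi) &
      forall P : Spec B, bijective (residue_map psi P)].

Definition weakly_subintegral :=
  [/\ finite_reduced_extension, bijective (Spec_map psi) &
      forall P : Spec B, purely_inseparable_map (residue_map psi P)].
End WeakNormality.

Section Closures.
Variables (A B : comNzRingType) (psi : {rmorphism A -> B}).

(* C is the largest subring of B containing A with A -> C (weakly)
   subintegral; A itself is identified with its image in B.  Only the subrings C
   need to be finite over A, so the definition makes sense for any B. *)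
Definition is_seminormalization (C : subring B) :=
  (exists h : range psi `<=` subring_set C, subintegral (corestr h)) /\
  forall (C' : subring B) (h : range psi `<=` subring_set C'),
    subintegral (corestr h) -> subring_set C' `<=` subring_set C.

Definition is_weak_normalization (C : subring B) :=
  (exists h : range psi `<=` subring_set C, weakly_subintegral (corestr h)) /\
  forall (C' : subring B) (h : range psi `<=` subring_set C'),
    weakly_subintegral (corestr h) -> subring_set C' `<=` subring_set C.

Definition seminormal_in := is_seminormalization (image_subring psi).
Definition weakly_normal_in := is_weak_normalization (image_subring psi).
End Closures.

Definition seminormal (A : comNzRingType) :=
  reduced A /\ seminormal_in (to_integral_closure (to_total A)).
Definition weakly_normal (A : comNzRingType) :=
  reduced A /\ weakly_normal_in (to_integral_closure (to_total A)).

(* Main.v *)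
Require Import Defs.
From mathcomp Require Import all_boot all_order all_algebra.
From mathcomp Require Import boolp classical_sets.
From mathcomp Require Import ring.

(* Let A be a local ring with maximal ideal m, inside C.  If x in C satisfies
   m^N x in A and x^p in A, the connecting map H^0_m(C/A) -> H^1_m(A) sends x to
   a class killed by Frobenius; when A is F-injective the class is 0, so x lies
   in A as soon as m contains a regular element of C.

   Now let R -> C be finite and weakly subintegral, with C inside the total
   ring of fractions and conductor I, and suppose C <> R.  At a minimal prime P
   of I, the radical of I C_P is the only prime of C_P over P, and its residue
   field is purely inseparable over that of P; so every x in C has x^(p^e) in
   R_P for some e, and P^N C_P lies in R_P for some N.  The last power x^(p^e)
   outside R_P then contradicts the first paragraph. *)

Set Implicit Arguments.
Unset Strict Implicit.
Unset Printing Implicit Defensive.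

Import GRing.Theory.
Local Open Scope ring_scope.
Local Open Scope classical_set_scope.

(** * Ideals, primes and powers in characteristic p *)

Lemma ideal_sum (R : comNzRingType) (I : ideal R) (T : Type) (s : seq T)
    (Q : pred T) (f : T -> R) :
  (forall i, Q i -> I (f i)) -> I (\sum_(i <- s | Q i) f i).
Proof.
by move=> If; elim/big_ind: _ => //; [exact: ideal0 | exact: idealD].
Qed.

Lemma ideal_mulr (R : comNzRingType) (I : ideal R) a x : I x -> I (x * a).
Proof. by rewrite mulrC; apply: idealM. Qed.

Lemma idealX_ge (R : comNzRingType) (I : ideal R) x m n :
  (m <= n)%N -> I (x ^+ m) -> I (x ^+ n).
Proof. by move=> /subnKC<-; rewrite exprD; apply: ideal_mulr. Qed.

Lemma primeX (R : comNzRingType) (P : Spec R) x n : P (x ^+ n) -> P x.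
Proof.
elim: n => [|n IHn]; first by rewrite expr0 => /prime_proper.
by rewrite exprS => /prime_mul[].
Qed.

Lemma prime_prod (R : comNzRingType) (P : Spec R) (T : Type) (s : seq T)
    (Q : pred T) (f : T -> R) :
  (forall i, Q i -> ~ P (f i)) -> ~ P (\prod_(i <- s | Q i) f i).
Proof.
move=> nP; elim/big_ind: _ => //; first exact: (@prime_proper _ P).
by move=> x y nx ny /prime_mul[].
Qed.

(** Proof irrelevance identifies the proof fields. Bijectivity of a map of spectra refers to
    equality of these records, so it can then be checked on elements. *)
Lemma Spec_eq (R : comNzRingType) (P Q : Spec R) :
  (forall x, P x <-> Q x) -> P = Q.
Proof.
case: P Q => [[I I0 ID IM] I1 II] [[J J0 JD JM] J1 JJ] /= h.
have e : I = J by apply/funext => x; apply/propext/h.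
subst J.
rewrite (Prop_irrelevance J0 I0) (Prop_irrelevance JD ID).
rewrite (Prop_irrelevance JM IM) in J1 JJ h *.
by rewrite (Prop_irrelevance J1 I1) (Prop_irrelevance JJ II).
Qed.

Lemma exprDp (R : comNzRingType) p (hR : p \in [pchar R]) e (x y : R) :
  (x + y) ^+ (p ^ e) = x ^+ (p ^ e) + y ^+ (p ^ e).
Proof.
apply: exprDn_pchar.
by rewrite (eq_pnat _ (pcharf_eq hR)) pnatX pnat_id // (pcharf_prime hR).
Qed.

Lemma exprBp (R : comNzRingType) p (hR : p \in [pchar R]) e (x y : R) :
  (x - y) ^+ (p ^ e) = x ^+ (p ^ e) - y ^+ (p ^ e).
Proof. by apply: (addIr (y ^+ (p ^ e))); rewrite -exprDp // !subrK. Qed.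

Lemma leq_pexp R p (hR : p \in [pchar R]) e : (e <= p ^ e)%N.
Proof. exact: ltnW (ltn_expl _ (prime_gt1 (pcharf_prime hR))). Qed.

(** * Radicals, colon ideals, noetherian arguments and primes from Zorn's lemma *)

Section Radical.
Variables (R : comNzRingType) (p : nat) (hR : p \in [pchar R]) (I : ideal R).

(* In characteristic p it suffices to test p^e-th powers, which are additive. *)
Definition radical_set : set R := [set x | exists e, I (x ^+ (p ^ e))].

Lemma radical0 : radical_set 0.
Proof. by exists 0%N; rewrite expr1; apply: ideal0. Qed.
Lemma radicalD x y : radical_set x -> radical_set y -> radical_set (x + y).
Proof.
move=> [e Ie] [f If]; exists (e + f)%N; rewrite exprDp // expnD.
apply: idealD; first by apply: idealX_ge Ie; rewrite leq_pmulr // expn_gt0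
  prime_gt0 // (pcharf_prime hR).
by apply: idealX_ge If; rewrite leq_pmull // expn_gt0
  prime_gt0 // (pcharf_prime hR).
Qed.
Lemma radicalM a x : radical_set x -> radical_set (a * x).
Proof. by move=> [e Ie]; exists e; rewrite exprMn; apply: idealM. Qed.
Definition radical := Ideal radical0 radicalD radicalM.

End Radical.

Section Colon.
Variables (R : comNzRingType) (I : ideal R) (t : R).
Definition colon_set : set R := [set x | I (t * x)].
Lemma colon0 : colon_set 0.
Proof. by rewrite /colon_set /= mulr0; apply: ideal0. Qed.
Lemma colonD x y : colon_set x -> colon_set y -> colon_set (x + y).
Proof. by rewrite /colon_set /= mulrDr; apply: idealD. Qed.
Lemma colonM a x : colon_set x -> colon_set (a * x).
Proof. by rewrite /colon_set /= mulrCA; apply: idealM. Qed.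
Definition colon := Ideal colon0 colonD colonM.
End Colon.

Lemma ideal_gens (R : comNzRingType) (I : ideal R) (s : seq R) :
  (forall x, I x <-> exists c : nat -> R, x = \sum_(i < size s) c i * s`_i) ->
  forall i : 'I_(size s), I s`_i.
Proof.
move=> sP i; apply/sP; exists (fun j => (j == i :> nat)%:R).
rewrite (bigD1 i) //= eqxx mul1r big1 ?addr0 // => j ji.
by rewrite val_eqE (negPf ji) mul0r.
Qed.

(** Without a maximal member, choice yields a strictly increasing sequence in [F]. Its union is an
    ideal whose finitely many generators all lie in one stage [N], so the sequence cannot grow after
    [N]. *)
Lemma noetherian_max (R : comNzRingType) (F : ideal R -> Prop) (I0 : ideal R) :
  noetherian R -> F I0 ->
  exists2 I, F I & forall K, F K -> I `<=` K -> K `<=` I.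
Proof.
move=> noeth FI0; apply: contrapT => nmax.
have next (I : {I | F I}) : exists K : {I | F I},
    sval I `<=` sval K /\ ~ (sval K `<=` sval I).
  apply: contrapT => nK; apply: nmax; exists (sval I); first exact: svalP.
  move=> K FK IK; apply: contrapT => nKI.
  by apply: nK; exists (exist _ K FK).
have [g gP] := choice next.
pose u n := ideal_set (sval (iter n g (exist _ I0 FI0))).
have u_mono m n : (m <= n)%N -> u m `<=` u n.
  move=> /subnKC<-; elim: (n - m)%N => [|d IHd]; first by rewrite addn0.
  by rewrite addnS => x /IHd; apply: (gP _).1.
have U0 : (\bigcup_n u n) 0 by exists 0%N => //; apply: ideal0.
have UD x y : (\bigcup_n u n) x -> (\bigcup_n u n) y -> (\bigcup_n u n) (x + y).
  move=> [m _ um] [n _ un]; exists (maxn m n) => //.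
  by apply: idealD; [apply: u_mono um|apply: u_mono un];
    rewrite (leq_maxl, leq_maxr).
have UM a x : (\bigcup_n u n) x -> (\bigcup_n u n) (a * x).
  by move=> [m _ um]; exists m => //; apply: idealM.
have [s sP] := noeth (Ideal U0 UD UM).
have sU (i : 'I_(size s)) : exists n, u n s`_i.
  by have [n _ un] := ideal_gens sP i; exists n.
have [n nP] := choice sU.
pose N := (\max_i n i)%N.
apply: (gP (iter N g (exist _ I0 FI0))).2 => x ux.
have /sP[c ->] : (\bigcup_n u n) x by exists N.+1.
apply: ideal_sum => i _; apply: idealM.
by apply: u_mono (nP i); apply: (leq_bigmax i).
Qed.

(* Among the ideals (J : t) with t outside the radical ideal J, a maximal one
   is prime, and then P t `<=` J with t outside P. *)
Lemma exists_generic_prime (R : comNzRingType) (J : ideal R) :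
    noetherian R -> (forall x n, J (x ^+ n) -> J x) -> ~ J 1 ->
  exists (P : Spec R) (t : R),
    [/\ J `<=` P, ~ P t & forall x, P x -> J (t * x)].
Proof.
move=> noeth Jrad J1.
pose F K := exists2 t, ~ J t & K = colon J t.
have [|_ [t Jt ->] tmax] := noetherian_max (F := F) (I0 := colon J 1) noeth.
  by exists 1.
have proper : ~ colon J t 1 by rewrite /= /colon_set /= mulr1.
have prim x y : colon J t (x * y) -> colon J t x \/ colon J t y.
  move=> txy; have [tx|ntx] := pselect (colon J t x); [by left|right].
  (* Since [t * x] is outside [J], the larger ideal (J : tx) also belongs to [F]; by maximality it
     equals (J : t), and it contains [y]. *)
  apply: (tmax (colon J (t * x))); first by exists (t * x).
    move=> z; rewrite /= /colon_set /= => tz.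
    by rewrite mulrAC; apply: ideal_mulr.
  by move: txy; rewrite /= /colon_set /= mulrA.
exists (Prime proper prim), t; split=> //.
  by move=> x Jx; apply: idealM.
by rewrite /= /colon_set /= => tt; apply: Jt; apply: (Jrad t 2); rewrite expr2.
Qed.

(* Expanding a long product of linear combinations of the generators of J, some
   generator occurs at least k times in each term, by pigeonhole. *)
Lemma radical_nilpotent (R : comNzRingType) (I J : ideal R) :
    noetherian R -> (forall x, J x -> exists n, I (x ^+ n)) ->
  exists M, forall a : 'I_M -> R, (forall i, J (a i)) -> I (\prod_i a i).
Proof.
move=> noeth JI; have [s sP] := noeth J.
have sI (i : 'I_(size s)) : exists n, I (s`_i ^+ n).
  exact/JI/(ideal_gens sP).
have [n nP] := choice sI.
pose k := (\max_i n i)%N; have {}nP (i : 'I_(size s)) : I (s`_i ^+ k).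
  by apply: (idealX_ge _ (nP i)); apply: (leq_bigmax i).
exists (size s * k).+1 => a Ja.
have [c cP] := choice (fun i => (sP (a i)).1 (Ja i)).
rewrite (eq_bigr _ (fun i _ => cP i)) bigA_distr_bigA /=.
apply: ideal_sum => f _; rewrite big_split /=; apply: idealM.
rewrite (partition_big f xpredT) //=.
have [i ki] : exists i, (k <= #|[pred j | f j == i]|)%N.
  apply: contrapT => nk; have := card_ord (size s * k).+1.
  rewrite -sum1_card (partition_big f xpredT) //= => /eqP.
  apply/negP; rewrite neq_ltn ltnS; apply/orP; left.
  have sumk : (\sum_(j < size s) k = size s * k)%N.
    by rewrite sum_nat_const card_ord.
  rewrite -[leqRHS]sumk; apply: leq_sum => i _.
  rewrite sum1_card leqNgt; apply/negP => /ltnW ki; apply: nk; exists i.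
  exact: ki.
rewrite (bigD1 i) //=; apply: ideal_mulr.
rewrite (eq_bigr (fun=> s`_i)); last by move=> j /eqP->.
by rewrite prodr_const; apply: (idealX_ge ki (nP i)).
Qed.

(** An ideal maximal among those containing [K] and missing [S] is prime: if x and y lie outside it,
    some s and t in [S] are multiples of x and y modulo it, so xy inside it would force st inside
    it. *)
Lemma exists_prime_avoiding (R : comNzRingType) (K : ideal R) (S : denoms K) :
  exists2 Q : Spec R, K `<=` Q & forall s, S s -> ~ Q s.
Proof.
pose F (A : set R) := A = set0 \/
  exists L : ideal R, [/\ A = L, K `<=` L & forall s, S s -> ~ L s].
have [A [FA Amax]] : exists A, F A /\ forall B, A `<` B -> ~ F B.
  apply: Zorn_bigcup => G GF Gtot.
  have [[X GX [x Xx]]|G0] := pselect (exists2 X, G X & X !=set0); last first.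
    left; apply/seteqP; split=> // x [X GX Xx].
    by case: G0; exists X => //; exists x.
  have idl Y y : G Y -> Y y ->
      exists L : ideal R, [/\ Y = L, K `<=` L & forall s, S s -> ~ L s].
    by move=> /GF[->|].
  right; pose U := \bigcup_(X in G) X.
  have U0 : U 0.
    by exists X => //; have [L [-> _ _]] := idl _ _ GX Xx; apply: ideal0.
  have UD y z : U y -> U z -> U (y + z).
    move=> [Y GY Yy] [Z GZ Zz]; have [YZ|ZY] := Gtot _ _ GY GZ.
      exists Z => //; have [L [ZL _ _]] := idl _ _ GZ Zz.
      by move: YZ Zz; rewrite ZL => YZ Zz; apply: idealD => //; apply: YZ.
    exists Y => //; have [L [YL _ _]] := idl _ _ GY Yy.
    by move: ZY Yy; rewrite YL => ZY Yy; apply: idealD => //; apply: ZY.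
  have UM a y : U y -> U (a * y).
    move=> [Y GY Yy]; exists Y => //; have [L [YL _ _]] := idl _ _ GY Yy.
    by move: Yy; rewrite YL; apply: idealM.
  exists (Ideal U0 UD UM); split=> //.
    move=> y Ky; exists X => //; have [L [XL KL _]] := idl _ _ GX Xx.
    by rewrite XL; apply: KL.
  move=> s Ss [Y GY Ys]; have [L [YL _ nL]] := idl _ _ GY Ys.
  by apply: nL Ss _; rewrite -YL.
have {FA} [A0|[L [AL KL nL]]] := FA.
  exfalso; apply: (Amax K); last first.
    by right; exists K; split=> // s /denoms_disj.
  by rewrite A0; split=> // K0; apply: (K0 0); apply: ideal0.
have {Amax}Lmax (L' : ideal R) x :
    L `<=` L' -> L' x -> ~ L x -> exists2 s, S s & L' s.
  move=> LL' L'x Lx; apply: contrapT => nS; apply: (Amax L').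
    by rewrite AL; split=> // L'L; apply/Lx/L'L.
  right; exists L'; split=> //; first by move=> y /KL/LL'.
  by move=> s Ss L's; apply: nS; exists s.
have proper : ~ L 1 by apply/nL/denoms1.
have adj x : ~ L x -> exists2 s, S s & exists a, L (s - a * x).
  move=> Lx; pose V := [set y | exists a, L (y - a * x)].
  have V0 : V 0 by exists 0; rewrite mul0r subrr; apply: ideal0.
  have VD y z : V y -> V z -> V (y + z).
    move=> [a La] [b Lb]; exists (a + b).
    by apply: ideal_eq (idealD La Lb) _; ring.
  have VM b y : V y -> V (b * y).
    move=> [a La]; exists (b * a).
    by apply: ideal_eq (idealM b La) _; ring.
  apply: (Lmax (Ideal V0 VD VM) x) => //.
    by move=> y Ly; exists 0; rewrite mul0r subr0.
  by exists 1; rewrite mul1r subrr; apply: ideal0.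
have prim x y : L (x * y) -> L x \/ L y.
  move=> Lxy; have [Lx|/adj[s Ss [a sa]]] := pselect (L x); [by left|].
  have [Ly|/adj[t St [b tb]]] := pselect (L y); [by right|].
  exfalso; apply: nL (denomsM Ss St) _.
  apply: ideal_eq (idealD (idealD (idealM t sa) (idealM (a * x) tb))
    (idealM (a * b) Lxy)) _.
  by ring.
by exists (Prime proper prim).
Qed.

(** * Fraction rings and the connecting map in local cohomology *)

Lemma to_frac_den (R : comNzRingType) (I : ideal R) (W : denoms I) a s
    (Ws : W s) :
  Defs.frac a Ws * to_frac W s = to_frac W a.
Proof. by rewrite /to_frac fracM; apply: frac_eq; ring. Qed.

Lemma to_frac_lreg (R : comNzRingType) (I : ideal R) (W : denoms I) s :
  W s -> GRing.lreg (to_frac W s).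
Proof.
move=> Ws x y; elim/fracW: x => a u Wu; elim/fracW: y => b v Wv.
rewrite /to_frac !fracM => /fracP[w Ww Iw]; apply/fracP.
exists (w * s); first exact: denomsM.
by apply: ideal_eq Iw _; ring.
Qed.

(** The element of [V] that kills the difference of two fractions comes from [W], so the relation
    pulls back along the injection [phi]. *)
Lemma frac_map_inj (A B : comNzRingType) (phi : {rmorphism A -> B})
    (W : denoms (zero_ideal A)) (V : denoms (zero_ideal B))
    (phi0 : forall x, zero_ideal A x -> zero_ideal B (phi x))
    (phiW : forall x, W x -> V (phi x)) :
  injective phi -> V `<=` phi @` W -> injective (frac_morph phi0 phiW).
Proof.
move=> phi_inj VW x y; elim/fracW: x => a s Ws; elim/fracW: y => b t Wt.
rewrite /= !(frac_mapE phi0) => /fracP[_ /VW[v Wv <-] abv].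
apply/fracP; exists v => //; apply: phi_inj.
by rewrite rmorph0 -[RHS]abv !(rmorphM, rmorphB).
Qed.

(* The class of x is the image of x under the connecting map from
   H^0_m(C / A) to H^1_m(A): lift the resolution e : A -> J to g : C -> J 0 and
   take d (g x).  Its image under Frobenius is the class of x^p, which is 0. *)
Lemma connecting_class_vanishes (A C : comNzRingType) p (hA : p \in [pchar A])
    (phi : {rmorphism A -> C}) (m : set A) (x : C) N :
    injective phi ->
    local_cohomology_injective m (restr_map (Frobenius hA)) 1 ->
    (forall a : 'I_N -> A, (forall i, m (a i)) ->
       range phi (phi (\prod_i a i) * x)) ->
    range phi (x ^+ p) ->
  exists r N', forall a : 'I_N' -> A, (forall i, m (a i)) ->
    phi (\prod_i a i) * (x - phi r) = 0.
Proof.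
move=> phi_inj [J [e [J' [e' [f]]]]].
move=> [[_ Jinj einj ker0 _] [_ _ _ ker0' _] fe fd H1inj] mx [b _ xp].
have [g ge] := Jinj 0 A^o (restr phi) (restr_map phi) e phi_inj.
have gscale (a c : A) : phi a * x = phi c -> a *: g x = e c.
  by move=> ac; rewrite -linearZ -ge; congr (g _); exact: ac.
have [|||z [M zM] dz] := H1inj (diff J 0 1 (g x)); last 1 first.
- have [r gxz] : exists r, g x - z = e r.
    by apply/ker0; rewrite linearB dz subrr.
  (* The last [N] factors carry [x] into A and the first [M] kill [z]; together they kill x - r, by
     injectivity of [e]. *)
  exists r, (M + N)%N => a ma; rewrite big_split_ord /= rmorphM.
  have [|c _ cx] := mx (fun i => a (rshift M i)) => //.
  have /zM : forall i, m (a (lshift N i)) by [].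
  set s := \prod_i a (lshift N i); set t := \prod_i _ in cx * => sz.
  have : e (s * (c - t * r)) = 0.
    have -> : s * (c - t * r) = s *: (c - t *: r : A^o) by [].
    rewrite linearZ_LR linearB linearZ_LR -gxz -(gscale t c) //.
    rewrite [t *: (_ - _)]scalerBr opprB addrC subrK scalerA mulrC -scalerA.
    by have -> : s *: (z : J 0) = 0 by []; rewrite scaler0.
  rewrite -[RHS](linear0 e) => /einj/(congr1 phi).
  rewrite rmorph0 rmorphM rmorphB cx rmorphM => <-; ring.
- exists N => a /mx[c _ cx]; rewrite -linearZ (gscale _ c) //.
  by apply/ker0; exists c.
- exact: diff_diff.
(* Here [b] is x^p. On the Frobenius module t acts as t^p, and tx = c gives t^p b = c^p, so such a t
   kills this element; subtracting [e' b] does not change the differential. *)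
- exists (f 0 (g x) - e' b).
    exists N => a /mx[c _ cx]; set t := \prod_i a i in cx *.
    rewrite scalerBr -[t *: e' b]linearZ_LR -[t *: f _ _]linearZ_LR.
    rewrite (gscale t c) // fe -linearB -[RHS](linear0 e'); congr (e' _).
    apply/eqP; rewrite subr_eq0; apply/eqP/phi_inj.
    rewrite /restr_map /= /restr_scale /Frobenius !pFrobenius_autE.
    by rewrite rmorphXn cx exprMn -xp rmorphM rmorphXn.
  rewrite fd linearB; have -> : diff J' 0 1 (e' b) = 0 by apply/ker0'; exists b.
  by rewrite subr0.
Qed.

(** * Localization at a prime of the base ring *)

Local Notation local_denoms P :=
  (Denoms (@prime_compl1 _ P) (@prime_complM _ P) (@prime_compl_disj0 _ P)).

Lemma local_nonunit (R : comNzRingType) (P : Spec R) (x : local_at P) :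
  @nonunits _ x ->
  exists a s, [/\ P a, ~ P s & x * to_local P s = to_local P a].
Proof.
elim/fracW: x => a s Ps nu; exists a, s; split=> //; last exact: to_frac_den.
apply: contrapT => Pa; apply: nu.
exists (@Defs.frac _ _ (local_denoms P) s a Pa).
by rewrite fracM; apply: frac_eq; ring.
Qed.

Lemma to_local_nonunit (R : comNzRingType) (P : Spec R) a :
  P a -> @nonunits (local_at P) (to_local P a).
Proof.
move=> Pa [x]; elim/fracW: x => b s Ps; rewrite fracM => /fracP[u Pu].
rewrite /zero_ideal /= => /eqP.
rewrite !mulr1 !mul1r mulrBr subr_eq0 => /eqP us.
by have /prime_mul[] : P (u * s)
  by rewrite -us; apply: idealM; apply: ideal_mulr.
Qed.

Section LocalExtension.
Variables (R C : comNzRingType) (phi : {rmorphism R -> C}) (P : Spec R).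
Hypothesis phi_inj : injective phi.

Let S : set C := phi @` (~` ideal_set P).

Lemma image_compl1 : S 1.
Proof. by exists 1; [exact: prime_proper | exact: rmorph1]. Qed.
Lemma image_complM x y : S x -> S y -> S (x * y).
Proof.
move=> [a Pa <-] [b Pb <-]; exists (a * b); last exact: rmorphM.
by move=> /prime_mul[].
Qed.
Lemma image_compl_disj x : S x -> ~ zero_ideal C x.
Proof.
by move=> [a Pa <-]; rewrite /= -(rmorph0 phi) => /phi_inj a0; apply: Pa;
  rewrite a0; apply: ideal0.
Qed.

(** [frac_ring W] is C_P, the localization of C at the complement of P in R; [phiP] is the induced
    map from R_P to C_P. *)
Let W := Denoms image_compl1 image_complM image_compl_disj.

Lemma phi_zero x : zero_ideal R x -> zero_ideal C (phi x).
Proof. by move=> ->; rewrite /= rmorph0. Qed.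
Lemma phi_compl x : local_denoms P x -> W (phi x).
Proof. by move=> Px; exists x. Qed.

Let phiP : {rmorphism local_at P -> frac_ring W} :=
  frac_morph phi_zero phi_compl.

Let phiP_inj : injective phiP. Proof. exact: frac_map_inj. Qed.

Let phiP_to_local a : phiP (to_local P a) = to_frac W (phi a).
Proof.
by rewrite /= (frac_mapE phi_zero); apply: frac_eq; rewrite rmorph1.
Qed.

Let phiP_den a s (Ps : local_denoms P s) :
  to_frac W (phi s) * phiP (Defs.frac a Ps) = to_frac W (phi a).
Proof. by rewrite /= (frac_mapE phi_zero) mulrC to_frac_den. Qed.

(** This is the vanishing of the connecting class over R_P, with denominators cleared: [s] and [w]
    are units there, so the hypothesis says that P^M x lies in R_P and the conclusion that x does.
    The regular element [d] of P removes the torsion. *)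
Lemma F_injective_pth_root p (hR : p \in [pchar R]) (x : C) d s M :
    F_injective_local (rmorph_pchar (to_local P) hR) ->
    P d -> GRing.lreg (phi d) -> ~ P s ->
    (forall a : 'I_M -> R, (forall i, P (a i)) ->
       range phi (phi (s * \prod_i a i) * x)) ->
    range phi (x ^+ p) ->
  exists2 w, ~ P w & range phi (phi w * x).
Proof.
move=> Finj Pd dreg Ps Mx [b _ xp].
have [||r [N rN]] := @connecting_class_vanishes _ _ _ _ phiP
    (@nonunits (local_at P)) (to_frac W x) M phiP_inj (Finj 1).
(* Nonunits of R_P are fractions n/v with n in P and v outside P, so the product times x has
   denominator [s * \prod_i v i]. *)
- move=> a /(_ _)/local_nonunit aP.
  have [n nP] := choice aP; have [v vP] := choice nP.
  have [|c _ cx] := Mx n; first by move=> i; have [] := vP i.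
  have sv : ~ P (s * \prod_i v i).
    by apply: prime_complM => //; apply: prime_prod => i _; have [] := vP i.
  exists (@Defs.frac _ _ (local_denoms P) c _ sv) => //.
  apply: (@to_frac_lreg _ _ W (phi (s * \prod_i v i))); first exact: phi_compl.
  rewrite phiP_den cx (rmorphM (to_frac W)) mulrA; congr (_ * _).
  rewrite -[LHS]phiP_to_local -phiP_to_local -(rmorphM phiP).
  apply: (congr1 phiP).
  rewrite !(rmorphM (to_local P)) -mulrA; congr (_ * _).
  rewrite !rmorph_prod mulrC -big_split; apply: eq_bigr => i _.
  by have [] := vP i.
- by exists (to_local P b) => //; rewrite phiP_to_local xp rmorphXn.
(* Taking every factor equal to [d] and r = r/u gives w d^N (ux - r) = 0 in C for some w outside P;
   then d^N cancels. *)
have := rN (fun=> to_local P d) (fun=> to_local_nonunit Pd).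
move=> {rN}; elim/fracW: r => r u Pu.
rewrite prodr_const card_ord -rmorphXn phiP_to_local.
move=> /(congr1 ( *%R (to_frac W (phi u)))).
rewrite mulr0 mulrCA mulrBr phiP_den.
rewrite -rmorphM -rmorphB -rmorphM -(rmorph0 (to_frac W)).
move=> /fracP[_ [w Pw <-]].
rewrite /= !mulr1 subr0 rmorphXn mulrCA => dw.
exists (w * u); first exact: prime_complM.
exists (w * r) => //; apply/eqP; rewrite eq_sym -subr_eq0; apply/eqP.
apply: (@lregX _ _ N dreg); rewrite mulr0 -[RHS]dw !rmorphM; ring.
Qed.
End LocalExtension.

(** * The conductor, and primes over P in a weakly subintegral extension *)

Section Conductor.
Variables (R C : comNzRingType) (phi : {rmorphism R -> C}).

Definition conductor_set : set R := [set r | forall c, range phi (phi r * c)].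
Lemma conductor0 : conductor_set 0.
Proof. by move=> c; rewrite rmorph0 mul0r; exists 0; rewrite ?rmorph0. Qed.
Lemma conductorD x y :
  conductor_set x -> conductor_set y -> conductor_set (x + y).
Proof.
move=> Ix Iy c; have [[a _ ax] [b _ bx]] := (Ix c, Iy c).
by exists (a + b) => //; rewrite !rmorphD ax bx mulrDl.
Qed.
Lemma conductorM a x : conductor_set x -> conductor_set (a * x).
Proof.
move=> Ix c; have [b _ bx] := Ix c.
by exists (a * b) => //; rewrite !rmorphM bx mulrA.
Qed.
Definition conductor := Ideal conductor0 conductorD conductorM.

(** A multiplier of all of C into R stays one after multiplication by c, so the conductor is an
    ideal of C too. *)
Lemma conductor_imageM r c :
  conductor r -> exists2 r', conductor r' & phi r' = c * phi r.
Proof.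
move=> Ir; have [r' _ rc] := Ir c; exists r'; last by rewrite rc mulrC.
by move=> c'; rewrite rc -mulrA; apply: Ir.
Qed.

(** The product of denominators of the module generators works. It serves both for [D] the
    complement of P and for [D] the elements regular in C. *)
Lemma finite_common_denominator (D : set R) :
    finitely_generated (restr phi) -> D 1 ->
    (forall x y, D x -> D y -> D (x * y)) ->
    (forall c, exists2 d, D d & range phi (phi d * c)) ->
  exists2 d, D d & conductor d.
Proof.
move=> [s sP] D1 DM Dc.
have /choice[d dP] (i : 'I_(size s)) :
    exists d, exists b, D d /\ phi b = phi d * (s`_i : C).
  by have [d Dd [b _ db]] := Dc s`_i; exists d, b.
have [b bP] := choice dP.
exists (\prod_i d i).
  by elim/big_ind: _ => // i _; have [] := bP i.
move=> c; have [a ->] := sP c.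
exists (\sum_i \prod_(j | j != i) d j * a i * b i) => //.
rewrite rmorph_sum mulr_sumr; apply: eq_bigr => i _.
have -> : a i *: s`_i = phi (a i) * (s`_i : C) by [].
rewrite [in RHS](bigD1 i) //= !(rmorphM phi) (bP i).2; ring.
Qed.

Variables (p : nat) (hR : p \in [pchar R]) (P : Spec R).
Let hC : p \in [pchar C] := rmorph_pchar phi hR.

Hypothesis phi_wsub : weakly_subintegral phi.
(** In other words, P R_P lies in the radical of I R_P, where I is the conductor. *)
Hypothesis radP : forall a, P a ->
  exists2 w, ~ P w & exists e, conductor (w * a ^+ (p ^ e)).

(* Up to localization at P this is the radical of the conductor in C, hence the
   prime of C over P. *)
Let K_set : set C := [set z | exists w e, ~ P w /\
  (phi @` conductor) (phi w * z ^+ (p ^ e))].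

(** Brings two elements to a common exponent, so that additivity of p^e-th powers applies. *)
Let K_raise z w e f : (phi @` conductor) (phi w * z ^+ (p ^ e)) ->
  (phi @` conductor) (phi w * z ^+ (p ^ (e + f))).
Proof.
move=> [r Ir rz].
have [r' Ir' r'r] := conductor_imageM (z ^+ (p ^ (e + f) - p ^ e)) Ir.
exists r' => //; rewrite r'r rz mulrCA -exprD subnK //.
by rewrite leq_exp2l ?leq_addr // prime_gt1 // (pcharf_prime hR).
Qed.

Let K0 : K_set 0.
Proof.
exists 1, 0%N; split; first exact: prime_proper.
by exists 0; [exact: ideal0 | rewrite expr1 mulr0 rmorph0].
Qed.

Let KD x y : K_set x -> K_set y -> K_set (x + y).
Proof.
move=> [v [e [Pv Kx]]] [w [f [Pw Ky]]]; exists (v * w), (e + f)%N.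
split; first exact: prime_complM.
have [r Ir rx] := K_raise f Kx.
have [s Is sy] := K_raise e Ky; rewrite addnC in sy.
exists (w * r + v * s); first by apply: idealD; apply: idealM.
by rewrite exprDp // rmorphD !rmorphM rx sy; ring.
Qed.

Let KM a x : K_set x -> K_set (a * x).
Proof.
move=> [w [e [Pw [r Ir rx]]]]; exists w, e; split=> //.
have [r' Ir' r'r] := conductor_imageM (a ^+ (p ^ e)) Ir.
by exists r' => //; rewrite r'r rx exprMn; ring.
Qed.

Let K := Ideal K0 KD KM.

(** If z were outside [K], some prime Q' containing [K] would avoid z and the image of the
    complement of P. By [radP] it also lies over P, so Q' = Q by injectivity on spectra, although z
    is in Q. *)
Let K_prime (Q : Spec C) z : (forall a, P a <-> Q (phi a)) -> Q z -> K z.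
Proof.
move=> PQ Qz; have [_ [g gl gr] _] := phi_wsub.
apply: contrapT => Kz.
pose S := [set c | exists s n, ~ P s /\ c = phi s * z ^+ n].
have S1 : S 1.
  by exists 1, 0%N; rewrite rmorph1 mulr1; split=> //; apply: prime_proper.
have SM x y : S x -> S y -> S (x * y).
  move=> [s [m [Ps ->]]] [t [n [Pt ->]]]; exists (s * t), (m + n)%N.
  split; first exact: prime_complM.
  by rewrite rmorphM exprD; ring.
have SK x : S x -> ~ K x.
  move=> [s [n [Ps ->]]] [w [e [Pw [r Ir rz]]]]; apply: Kz.
  exists (w * s ^+ (p ^ e)), (n + e)%N; split.
    by apply: prime_complM => // /primeX.
  (* The exponent n p^e of z is raised to a power of p; p^(n+e) is large enough because n <= p^n. *)
  have [r' Ir' r'r] := conductor_imageM (z ^+ (p ^ (n + e) - n * p ^ e)) Ir.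
  exists r' => //; rewrite r'r rz exprMn -exprM rmorphM rmorphXn.
  rewrite -[in RHS](@subnK (n * p ^ e) (p ^ (n + e))) ?exprD; first by ring.
  rewrite expnD leq_pmul2r ?(leq_pexp hR) //.
  by rewrite expn_gt0 prime_gt0 // (pcharf_prime hR).
have [Q' KQ' SQ'] := exists_prime_avoiding (Denoms S1 SM SK).
suff QQ' : Q = Q'.
  apply: (SQ' z); last by rewrite -QQ'.
  by exists 1, 1%N; rewrite rmorph1 mul1r; split=> //; apply: prime_proper.
apply: (can_inj gl); apply: Spec_eq => a; split.
  move=> /PQ /radP[w Pw [e Iwa]]; apply: KQ'; exists w, e; split=> //.
  by exists (w * a ^+ (p ^ e)); rewrite // rmorphM rmorphXn.
move=> Q'a; apply/PQ; apply: contrapT => Pa; apply: SQ' Q'a.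
by exists a, 0%N; rewrite mulr1.
Qed.

(** Pure inseparability at the prime Q over P gives r - u x^(p^e) in Q with u outside P. By
    [K_prime] a further p^f-th power of it lies in the conductor up to a factor outside P, and the
    conductor lies in R. *)
Lemma weakly_subintegral_pth_power x :
  exists w e, ~ P w /\ range phi (phi w * x ^+ (p ^ e)).
Proof.
have [_ [g gl gr] pins] := phi_wsub; pose Q := g P.
have PQ a : P a <-> Q (phi a) by rewrite -{1}(gr P).
have [n [pn [y _ yx]]] := pins Q (to_frac _ x).
have [e en] : exists e, n = (p ^ e)%N.
  suff /p_natP[e ->] : p.-nat n by exists e.
  have hQ := rmorph_pchar (to_frac (prime_compl Q)) hC.
  by rewrite -(eq_pnat _ (pcharf_eq hQ)).
elim/fracW: y yx => r u Qu; rewrite /= (frac_mapE (@residue_map_num _ _ phi Q)).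
rewrite -rmorphXn => /fracP[v Qv].
rewrite mulr1 => /prime_mul[//|Qd].
have [w [f [Pw [s _ sP]]]] := K_prime PQ Qd.
exists (w * u ^+ (p ^ f)), (e + f)%N; split.
  by apply: prime_complM => // /primeX /PQ.
exists (w * r ^+ (p ^ f) - s) => //.
rewrite rmorphB sP exprBp // exprMn -exprM en expnD !rmorphM !rmorphXn; ring.
Qed.

End Conductor.

(** * Triviality of weakly subintegral extensions of an F-injective ring *)

Lemma F_injective_no_weakly_subintegral (R C : comNzRingType) p
    (hR : p \in [pchar R]) (phi : {rmorphism R -> C}) :
    noetherian R -> F_injective hR -> weakly_subintegral phi ->
    (forall c, exists2 d, GRing.lreg (phi d) & range phi (phi d * c)) ->
  range phi = setT.
Proof.
move=> noeth Finj phi_wsub total; apply/seteqP; split=> // x0 _.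
have [[_ _ phi_inj phi_fin] _ _] := phi_wsub.
apply: contrapT => nx0; pose I := conductor phi; pose J := radical hR I.
have IJ x n : I (x ^+ n) -> J x.
  by move=> Ix; exists n; apply: idealX_ge Ix; apply: (leq_pexp hR).
have Jrad x n : J (x ^+ n) -> J x.
  by move=> [e Ie]; apply: (IJ x (n * p ^ e)%N); rewrite exprM.
have J1 : ~ J 1.
  by move=> [e]; rewrite expr1n => /(_ x0); rewrite rmorph1 mul1r.
(* As [t] is a unit in R_P, the radical of I R_P is P R_P; this replaces the choice of a minimal
   prime of I. *)
have [P [t [JP Pt tJ]]] := exists_generic_prime noeth Jrad J1.
have IP : I `<=` P by move=> x Ix; apply/JP/(IJ x 1%N).
have radP a : P a -> exists2 w, ~ P w & exists e, I (w * a ^+ (p ^ e)).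
  move=> /tJ[e Ie]; exists (t ^+ (p ^ e)); first by move=> /primeX.
  by exists e; rewrite -exprMn.
(* Otherwise C_P = R_P, and a common denominator outside P would lie in the conductor, which is
   contained in P. *)
have [x nx] : exists x, forall w, ~ P w -> ~ range phi (phi w * x).
  apply: contrapT => nx.
  have [||c|w Pw /IP//] := @finite_common_denominator _ _ phi (~` P) phi_fin.
  - exact: prime_proper.
  - exact: prime_complM.
  - apply: contrapT => nc; apply: nx; exists c => w Pw wc.
    by apply: nc; exists w.
(* The conductor, hence P, contains an element regular in C, since C has regular denominators. *)
have [||//|d dreg Id] :=
  @finite_common_denominator _ _ phi (fun d => GRing.lreg (phi d)) phi_fin.
- by rewrite rmorph1; apply: lreg1.
- by move=> y z; rewrite rmorphM; apply: lregM.
have [|M MI] := radical_nilpotent (I := I) (J := J) noeth.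
  by move=> y [e Ie]; exists (p ^ e)%N.
pose Q e := `[< exists w, ~ P w /\ range phi (phi w * x ^+ (p ^ e)) >].
have exQ : exists e, Q e.
  have [w [e wx]] := weakly_subintegral_pth_power hR phi_wsub radP x.
  by exists e; apply/asboolP; exists w.
case: (ex_minnP exQ) => -[|e] /asboolP[w [Pw wx]] min_e.
  by apply: (nx w Pw); rewrite expr1 in wx.
(* The exponent is the least one that brings x into R_P, so x^(p^e) is not in R_P; the factor
   [phi w] makes the p-th power lie in R itself. *)
have [||w' Pw' w'x] := F_injective_pth_root phi_inj (x := phi w * x ^+ (p ^ e))
    (M := M) (Finj P) (IP d Id) dreg (fun h : P (t ^+ M) => Pt (primeX h)).
(* Each t a_i lies in J, and products of [M] elements of J lie in I. *)
- move=> a Pa; suff : I (t ^+ M * \prod_i a i) by [].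
  rewrite -[X in t ^+ X]card_ord -prodr_const -big_split.
  by apply: MI => i; apply/tJ/Pa.
- have [r _ rx] := wx; exists (w ^+ p.-1 * r) => //.
  rewrite rmorphM rx exprMn -exprM -expnSr mulrA -rmorphM -exprSr prednK.
    by rewrite rmorphXn.
  exact/prime_gt0/(pcharf_prime hR).
suff /min_e : Q e by rewrite ltnn.
apply/asboolP; exists (w' * w); split; first exact: prime_complM.
by rewrite rmorphM -mulrA.
Qed.

(** * Isomorphisms, total fractions and the conclusion *)

Lemma inj_surj_bijective (T U : Type) (f : T -> U) :
  injective f -> (forall y, exists x, f x = y) -> bijective f.
Proof.
move=> f_inj /choice[g gP]; exists g => // x.
exact: f_inj (gP (f x)).
Qed.

Lemma purely_inseparable_surj (K L : comNzRingType) (h : {rmorphism K -> L}) :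
  (forall y, exists x, h x = y) -> purely_inseparable_map h.
Proof.
by move=> hs y; exists 1%N; have [x <-] := hs y; split=> //; exists x.
Qed.

Lemma subintegralW (A B : comNzRingType) (phi : {rmorphism A -> B}) :
  subintegral phi -> weakly_subintegral phi.
Proof.
move=> [ext specb resb]; split=> // P; apply: purely_inseparable_surj => y.
by have [g _ gK] := resb P; exists (g y).
Qed.

(** Primes and fractions transport along a bijection. This is needed because the image of R must
    itself qualify as a subintegral extension of R. *)
Lemma iso_subintegral (A B : comNzRingType) (phi : {rmorphism A -> B}) :
  reduced A -> injective phi -> (forall y, exists x, phi x = y) ->
  subintegral phi.
Proof.
move=> redA phi_inj phi_surj.
have image_mem (P : ideal A) a : (phi @` P) (phi a) <-> P a.
  by split=> [[b Pb /phi_inj<-]|Pa]; last exists a.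
split.
- split=> //.
  + move=> y n; have [x <-] := phi_surj y.
    by rewrite -rmorphXn -{1}(rmorph0 phi) => /phi_inj/redA->; rewrite rmorph0.
  + exists [:: 1] => y; have [x <-] := phi_surj y; exists (fun=> x).
    by rewrite big_ord1 /= -[LHS]mulr1.
- apply: inj_surj_bijective.
    move=> P Q PQ; apply: Spec_eq => y; have [x <-] := phi_surj y.
    by have -> : P (phi x) = Spec_map phi P x by []; rewrite PQ.
  move=> P.
  have I0 : (phi @` P) 0 by exists 0; [exact: ideal0|exact: rmorph0].
  have ID x y : (phi @` P) x -> (phi @` P) y -> (phi @` P) (x + y).
    move=> [a Pa <-] [b Pb <-]; exists (a + b); last exact: rmorphD.
    exact: idealD.
  have IM c x : (phi @` P) x -> (phi @` P) (c * x).
    move=> [a Pa <-]; have [b <-] := phi_surj c.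
    by exists (b * a); [exact: idealM|exact: rmorphM].
  have Q1 : ~ Ideal I0 ID IM 1.
    by rewrite /= -(rmorph1 phi) => /image_mem/prime_proper.
  have QM x y :
      Ideal I0 ID IM (x * y) -> Ideal I0 ID IM x \/ Ideal I0 ID IM y.
    have [[a <-] [b <-]] := (phi_surj x, phi_surj y).
    rewrite /= -rmorphM => /image_mem/prime_mul[Pa|Pb]; [left|right];
      exact/image_mem.
  by exists (Prime Q1 QM); apply: Spec_eq => a; apply: image_mem.
- move=> P; apply: inj_surj_bijective.
    move=> x y; elim/fracW: x => a s Ws; elim/fracW: y => b t Wt.
    rewrite /= !(frac_mapE (@residue_map_num _ _ phi P)) => /fracP[v].
    have [u <-] := phi_surj v; rewrite -!rmorphM -rmorphB -rmorphM => Wu Pu.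
    by apply/fracP; exists u.
  move=> y; elim/fracW: y => b t.
  have [[a <-] [s <-]] := (phi_surj b, phi_surj t) => Wt.
  exists (@Defs.frac _ _ (prime_compl (Spec_map phi P)) a s Wt).
  by rewrite /= (frac_mapE (@residue_map_num _ _ phi P)); apply: frac_eq.
Qed.

Lemma to_total_inj (R : comNzRingType) : injective (to_total R).
Proof.
move=> a b /fracP[u /= ureg]; rewrite !mulr1 => /eqP.
by rewrite -(mulr0 u) => /eqP/ureg/eqP; rewrite subr_eq0 => /eqP.
Qed.

(** Write [iota c] as a/s with s regular in R; s is still regular in C, because C embeds in the
    total ring of fractions, where s cancels. *)
Lemma total_denominator (R C : comNzRingType) (phi : {rmorphism R -> C})
    (iota : {rmorphism C -> total_fractions R}) (c : C) :
    injective iota -> (forall a, iota (phi a) = to_total R a) ->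
  exists2 d, GRing.lreg (phi d) & range phi (phi d * c).
Proof.
move=> iota_inj iota_phi.
have [a [s [Ws ac]]] : exists a s,
    regular_elts s /\ iota c * to_total R s = to_total R a.
  elim/fracW: (iota c) => a s Ws; exists a, s; split=> //.
  exact: to_frac_den.
exists s; last first.
  by exists a => //; apply: iota_inj; rewrite rmorphM !iota_phi mulrC ac.
move=> x y /(congr1 iota); rewrite !rmorphM !iota_phi.
pose W := Denoms (@regular1 R) (@regularM R) (@regular_disj R).
by move=> /(@to_frac_lreg _ _ W _ Ws)/iota_inj.
Qed.

Theorem theorem4p7 (p : nat) (k : fieldType) (hk : p \in [pchar k]%R)
    (R : comNzRingType) (hR : p \in [pchar R]%R) :
  noetherian R ->
  reduced R ->
  F_finite hR ->
  ess_finite_type k R ->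
  has_dualizing_complex R ->
  F_injective hR ->
  weakly_normal R /\ seminormal R.
Proof.
move=> noeth redR _ _ _ Finj.
pose psi := to_integral_closure (to_total R).
have psi_inj : injective psi by move=> a b /(congr1 val)/to_total_inj.
have corestr_inj C (h : range psi `<=` subring_set C) : injective (corestr h).
  by move=> a b /(congr1 val)/psi_inj.
pose iota (C : subring (subring_ring (integral_closure (to_total R)))) :
  {rmorphism subring_ring C -> total_fractions R} := val \o val.
have total C (h : range psi `<=` subring_set C) (c : subring_ring C) :
    exists2 d, GRing.lreg (corestr h d) & range (corestr h) (corestr h d * c).
  by apply: (total_denominator (iota := iota C)) => // x y /val_inj/val_inj.
have largest C (h : range psi `<=` subring_set C) :
    weakly_subintegral (corestr h) -> subring_set C `<=` image_subring psi.
  move=> wsub x Cx; have Cx' : subring_pred C x by apply/asboolP.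
  have := F_injective_no_weakly_subintegral noeth Finj wsub (total C h).
  move=> /seteqP[_ /(_ (exist _ x Cx') I)[a _ /(congr1 val) ax]].
  by exists a.
have hpsi : range psi `<=` image_subring psi by [].
have sub : subintegral (corestr hpsi).
  apply: iso_subintegral => //; first exact: corestr_inj.
  move=> [x]; move=> /[dup] /asboolP[a _ ax] Cx; exists a.
  exact/val_inj.
(* The image of R is the largest subring in both senses: a subintegral extension is weakly
   subintegral, so [largest] covers both. *)
split; split=> //; split.
- by exists hpsi; apply: subintegralW.
- exact: largest.
- by exists hpsi.
- by move=> C h /subintegralW; apply: largest.
Qed.
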